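(* Let $E$ be a Banach lattice and $Y$ a Banach space. If either $E$ is $\sigma$-laterally complete or $E$ is an AM-space with unit, then every order weakly compact operator from $E$ to $Y$ is disjoint weak Banach-Saks.
   Context: An operator is a bounded linear map. A sequence $(x_n)$ in a Banach lattice is disjoint if $|x_n|\wedge|x_m|=0$ for $n\ne m$. The Cesàro sequence of $(y_k)$ is $\left(\frac1m\sum_{k=1}^m y_k\right)_m$. An operator $T:E\to Y$ is disjoint weak Banach-Saks if for each disjoint weakly null sequence $(x_n)$ of $E$, $(T(x_n))$ has a subsequence whose Cesàro sequence is norm convergent in $Y$. An operator $T:E\to Y$ is order weakly compact if and only if $\|T(x_n)\|\to0$ for every order bounded disjoint sequence $(x_n)$ of $E$. A vector lattice $E$ is $\sigma$-laterally complete if the supremum of every disjoint sequence of $E^+$ exists in $E$. *)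

(* Defs.v *)
From HB Require Import structures.
From mathcomp Require Import all_boot all_order all_algebra.
From mathcomp Require Import all_classical all_reals all_analysis.

Set Implicit Arguments.
Unset Strict Implicit.
Unset Printing Implicit Defensive.

Import Order.TTheory GRing.Theory Num.Theory.
Import numFieldTopology.Exports numFieldNormedType.Exports.

Local Open Scope classical_set_scope.
Local Open Scope ring_scope.

(** Vector lattices.  [Order.Lattice] is not an ancestor of this structure, as
    HB would require a join of it with [GRing.Zmodule] declared before
    [Num.RealDomain]; it is instead attached to the carriers below. *)
HB.mixin Record Lmodule_isVectorLattice (R : realType) (E : Type)
    & GRing.Lmodule R E := {
  vle : rel E ;
  vmeet : E -> E -> E ;
  vjoin : E -> E -> E ;
  vle_refl : reflexive vle ;
  vle_anti : antisymmetric vle ;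
  vle_trans : transitive vle ;
  vle_meet : forall x y z, vle x (vmeet y z) = vle x y && vle x z ;
  vle_join : forall x y z, vle (vjoin x y) z = vle x z && vle y z ;
  vle_add2r : forall z x y, vle x y -> vle (x + z) (y + z) ;
  vle_scale2l : forall (a : R) x y, 0 <= a -> vle x y -> vle (a *: x) (a *: y)
}.

#[short(type="vectorLatticeType")]
HB.structure Definition VectorLattice (R : realType) :=
  {E of GRing.Lmodule R E & Lmodule_isVectorLattice R E}.

Section VectorLatticeOrder.
Context {R : realType} {E : vectorLatticeType R}.

(** With [ring_display], [x <= y] in [ring_scope] is the order of the lattice;
    [`|x|] still denotes the norm, the lattice absolute value being [labs]. *)
HB.instance Definition _ := Order.Le_isPOrder.Build ring_display
  (VectorLattice.sort E) (@vle_refl R E) (@vle_anti R E) (@vle_trans R E).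
HB.instance Definition _ := Order.POrder_MeetJoin_isLattice.Build ring_display
  (VectorLattice.sort E) (@vle_meet R E) (@vle_join R E).

Definition labs (x : E) : E := Order.join x (- x).

End VectorLatticeOrder.

HB.mixin Record NormedModule_VectorLattice_isNormedLattice
    (R : realType) (E : Type)
    & NormedModule R E & VectorLattice R E := {
  norm_le_labs : forall x y : E, labs x <= labs y -> `|x| <= `|y|
}.

#[short(type="banachLatticeType")]
HB.structure Definition BanachLattice (R : realType) :=
  {E of CompleteNormedModule R E & VectorLattice R E
   & NormedModule_VectorLattice_isNormedLattice R E}.

HB.instance Definition _ (R : realType) (E : banachLatticeType R) :=
  Order.Lattice.copy (BanachLattice.sort E)
    (VectorLattice.sort (E : vectorLatticeType R)).

Section VectorLatticeNotions.
Context {R : realType} {E : vectorLatticeType R}.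
Implicit Types (x : nat -> E) (e : E).

Definition disjoint_seq x : Prop :=
  forall n m : nat, n <> m -> Order.meet (labs (x n)) (labs (x m)) = 0.

Definition order_bounded_seq x : Prop :=
  exists a b : E, forall n, a <= x n /\ x n <= b.

Definition order_unit e : Prop :=
  0 < e /\ forall y : E, exists2 a : R, 0 < a & labs y <= a *: e.

End VectorLatticeNotions.

Definition sigma_laterally_complete (R : realType) (E : vectorLatticeType R) :
    Prop :=
  forall x : nat -> E, (forall n, 0 <= x n) -> disjoint_seq x ->
    exists s : E, isLub (range x) s.

Definition bounded_op (R : realType) (V W : normedModType R)
    (T : {linear V -> W}) : Prop :=
  bounded_near T (nbhs (0 : V)).

Definition weakly_null (R : realType) (V : normedModType R) (x : nat -> V) :
    Prop :=
  forall f : {linear V -> R^o}, bounded_op f ->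
    (fun n => f (x n)) @ \oo --> (0 : R^o).

(** Indices start at 0: the term of index [m] averages the [m.+1] first terms. *)
Definition cesaro (R : realType) (V : normedModType R) (y : nat -> V) :
    nat -> V :=
  fun m => m.+1%:R^-1 *: \sum_(k < m.+1) y k.

Definition AM_space (R : realType) (E : banachLatticeType R) : Prop :=
  forall x y : E, Order.meet x y = 0 ->
    `|Order.join x y| = Num.max `|x| `|y|.

(** The norm is not required to be the gauge norm of the unit.  On a Banach
    lattice, an order unit [e] such that [`|x|] is the infimum of the [a > 0]
    with [labs x <= a *: e] makes the norm an M-norm, so that convention is
    covered too. *)
Definition AM_space_with_unit (R : realType) (E : banachLatticeType R) : Prop :=
  AM_space E /\ exists e : E, order_unit e.

Section Operators.
Context {R : realType} {E : banachLatticeType R} {Y : normedModType R}.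
Implicit Type T : {linear E -> Y}.

Definition disjoint_weak_Banach_Saks T : Prop :=
  forall x : nat -> E, disjoint_seq x -> weakly_null x ->
    exists phi : nat -> nat, {homo phi : i j / (i < j)%N} /\
      exists l : Y, cesaro (fun k => T (x (phi k))) @ \oo --> l.

Definition order_weakly_compact T : Prop :=
  forall x : nat -> E, order_bounded_seq x -> disjoint_seq x ->
    (fun n => `|T (x n)|) @ \oo --> (0 : R).

End Operators.

(* Main.v *)
Require Import Defs.
From HB Require Import structures.
From mathcomp Require Import all_boot all_order all_algebra.
From mathcomp Require Import all_classical all_reals all_analysis.
From mathcomp Require Import ring lra.
Import Order.TTheory GRing.Theory Num.Theory.
Import numFieldTopology.Exports numFieldNormedType.Exports.
Local Open Scope classical_set_scope.
Local Open Scope ring_scope.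

(** In both cases a disjoint weakly null sequence [x] of [E] is order bounded.
    An order weakly compact [T] then gives [`|T (x n)| --> 0], and the Cesaro
    means of a null sequence tend to [0], so that no passage to a subsequence
    is needed.

    If [E] is sigma-laterally complete, the sequence of the [labs (x n)] is
    disjoint and positive, so it has a supremum, which bounds [x]
    ([sigma_laterally_complete_order_bounded]); disjointness alone matters.

    If [E] has an order unit [e], two facts combine.
    - There is a constant [C] with [labs y <= (C * `|y|) *: e] for all [y]
      ([order_unit_dominates]).  Otherwise some positive [z k] of norm [2^-k]
      fail [z k <= 2^k *: e]; their sum [s] converges by completeness and
      dominates each [z k], and any bound [s <= a *: e] is contradictory.
    - A weakly null sequence is norm bounded ([weakly_bounded_bounded]).
      Suppose that [`|z k| > k * 3^k] for some terms [z k] of the sequence, and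
      let [f k] be a functional of norm at most [1] norming [z k].  Signs can be
      chosen one after the other so that the [k]-th term of
      [F = \sum_k (+/-) 3^-k f k] does not cancel the previous ones at [z k];
      the tail of the series is at most half of that term, so
      [`|F (z k)| >= k / 2], and [F] is unbounded along the sequence.
    Norming functionals come from the Hahn-Banach theorem, proved by finding
    with Zorn's lemma a minimal sublinear functional below a given one: a
    minimal sublinear functional is linear. *)

Set Implicit Arguments.
Unset Strict Implicit.

(** * The Hahn-Banach theorem *)

(** Real-valued subadditive and positively homogeneous functions. *)
Definition sublinear (R : realType) (V : lmodType R) (p : V -> R) : Prop :=
  (forall x y, p (x + y) <= p x + p y) /\
  (forall a x, 0 <= a -> p (a *: x) = a * p x).

Lemma sublinear_subhomog (R : realType) (V : lmodType R) (p : V -> R) :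
  (forall x y, p (x + y) <= p x + p y) -> p 0 = 0 ->
  (forall a x, 0 < a -> p (a *: x) <= a * p x) -> sublinear p.
Proof.
move=> pD p0 pZ; split=> // a x; rewrite le_eqVlt => /predU1P[<-|a0].
  by rewrite scale0r mul0r.
apply/eqP; rewrite eq_le pZ//= -[X in _ * p X](scalerK (lt0r_neq0 a0)).
by rewrite -ler_pdivlMl// pZ// invr_gt0.
Qed.

Lemma sublinear0 (R : realType) (V : lmodType R) (p : V -> R) :
  sublinear p -> p 0 = 0.
Proof. by move=> [_ pZ]; rewrite -(scale0r 0) pZ// mul0r. Qed.

Lemma sublinear_geN (R : realType) (V : lmodType R) (p : V -> R) :
  sublinear p -> forall x, - p (- x) <= p x.
Proof.
move=> sp x; rewrite lerNl -subr_ge0 opprK -(sublinear0 sp) -(subrr x) addrC.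
exact: sp.1.
Qed.

(** The sublinear function [x |-> inf_(t >= 0) (p (x + t y) - t p y)]: it lies
    below [p], and its value at [- y] is at most [- p y]. *)
Definition lowering (R : realType) (V : lmodType R) (p : V -> R) (y x : V) : R :=
  inf [set p (x + t *: y) - t * p y | t in [set t | 0 <= t]].

Lemma lowering_lb (R : realType) (V : lmodType R) (p : V -> R) (y x : V) (t : R) :
  sublinear p -> 0 <= t -> - p (- x) <= p (x + t *: y) - t * p y.
Proof.
move=> [pD pZ] t0; rewrite -pZ// lerBrDr addrC lerBlDr.
by rewrite (le_trans _ (pD _ _))// addrAC subrr add0r.
Qed.

Lemma lowering_le (R : realType) (V : lmodType R) (p : V -> R) (y x : V) (t : R) :
  sublinear p -> 0 <= t -> lowering p y x <= p (x + t *: y) - t * p y.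
Proof.
move=> sp t0; apply: ge_inf; last by exists t.
by exists (- p (- x)) => _ [s s0 <-]; exact: lowering_lb.
Qed.

Lemma le_lowering (R : realType) (V : lmodType R) (p : V -> R) (y x : V) (c : R) :
  (forall t, 0 <= t -> c <= p (x + t *: y) - t * p y) -> c <= lowering p y x.
Proof.
move=> h; apply: lb_le_inf; first by exists (p (x + 0 *: y) - 0 * p y), 0 => /=.
by move=> _ [t t0 <-]; exact: h.
Qed.

Lemma lowering_le_self (R : realType) (V : lmodType R) (p : V -> R) (y x : V) :
  sublinear p -> lowering p y x <= p x.
Proof.
by move=> sp; have := lowering_le y x sp (lexx 0); rewrite scale0r mul0r addr0 subr0.
Qed.

Lemma lowering_sublinear (R : realType) (V : lmodType R) (p : V -> R) (y : V) :
  sublinear p -> sublinear (lowering p y).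
Proof.
move=> sp; have [pD pZ] := sp; apply: sublinear_subhomog => [x z||a x a0].
- rewrite -lerBlDr; apply: le_lowering => t t0.
  rewrite lerBlDr -lerBlDl; apply: le_lowering => s s0; rewrite lerBlDl.
  apply: le_trans (lowering_le y (x + z) sp (addr_ge0 t0 s0)) _.
  by rewrite scalerDl addrACA mulrDl opprD [leRHS]addrACA lerD2r.
- apply/eqP; rewrite eq_le -{1}(sublinear0 sp) lowering_le_self//=.
  by apply: le_lowering => t t0; rewrite add0r pZ// subrr.
- rewrite -ler_pdivrMl//; apply: le_lowering => t t0; rewrite ler_pdivrMl//.
  apply: le_trans (lowering_le y _ sp (mulr_ge0 (ltW a0) t0)) _.
  by rewrite -scalerA -scalerDr pZ ?(ltW a0)// mulrBr mulrA.
Qed.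

(** The pointwise infimum of a chain of sublinear functions below [p] is finite,
    as each of them is at least [- p (- x)] at [x], and it is sublinear. *)
Lemma exists_minimal_sublinear (R : realType) (V : lmodType R) (p : V -> R) :
  sublinear p -> exists q : V -> R, [/\ sublinear q, forall x, q x <= p x &
    forall r, sublinear r -> (forall x, r x <= q x) -> r = q].
Proof.
move=> sp; pose T := {q : V -> R | sublinear q /\ forall x, q x <= p x}.
pose below (s t : T) := `[< forall x, sval t x <= sval s x >].
have [|r s t|s t||q qmin] := @Zorn T below.
- by move=> t; apply/asboolP.
- by move=> /asboolP rs /asboolP st; apply/asboolP => x; exact: le_trans (rs x).
- move: s t => [s ps] [t pt] /asboolP/= ts /asboolP/= st.
  have {ts st} st : s = t by apply/funext => x; apply/eqP; rewrite eq_le st ts.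
  by case: t / st pt => pt; congr exist; exact: Prop_irrelevance.
- move=> A Atot; have [A0|/set0P[s0 As0]] := eqVneq A set0.
    by exists (exist _ p (conj sp (fun=> lexx _))) => s; rewrite A0.
  pose q (x : V) : R := inf [set sval s x | s in A].
  have qle s x : A s -> q x <= sval s x.
    move=> As; apply: ge_inf; last by exists s.
    exists (- p (- x)) => _ [[r [sr rp]]/= _ <-].
    by rewrite (le_trans _ (sublinear_geN sr x))// lerN2.
  have le_q (c : R) x : (forall s, A s -> c <= sval s x) -> c <= q x.
    move=> h; apply: lb_le_inf; first by exists (sval s0 x); exists s0.
    by move=> _ [s As <-]; exact: h.
  have sq : sublinear q.
    apply: sublinear_subhomog => [x z||a x a0].
    + rewrite -lerBlDr; apply: (le_q) => s As; rewrite lerBlDr -lerBlDl.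
      apply: (le_q) => t At; rewrite lerBlDl.
      have [/asboolP st|/asboolP ts] := Atot _ _ As At.
        rewrite (le_trans (qle t _ At))// (le_trans ((svalP t).1.1 x z))//.
        by rewrite lerD2r.
      rewrite (le_trans (qle s _ As))// (le_trans ((svalP s).1.1 x z))//.
      by rewrite lerD2l.
    + apply/eqP; rewrite eq_le -{1}(sublinear0 (svalP s0).1) qle//=.
      by apply: (le_q) => s As; rewrite (sublinear0 (svalP s).1).
    + rewrite -ler_pdivrMl//; apply: (le_q) => s As; rewrite ler_pdivrMl//.
      by rewrite -((svalP s).1.2 _ _ (ltW a0)) qle.
  have qp x : q x <= p x by rewrite (le_trans (qle s0 _ As0))// (svalP s0).2.
  by exists (exist _ q (conj sq qp)) => s As; apply/asboolP => x; exact: qle.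
exists (sval q); split; [exact: (svalP q).1|exact: (svalP q).2|move=> r sr rq].
have rp x : r x <= p x by rewrite (le_trans (rq x))// (svalP q).2.
by rewrite -(qmin (exist _ r (conj sr rp)))//; exact/asboolP.
Qed.

(** By minimality [lowering q y = q], and taking [t = 1] in the infimum gives
    [q x + q y <= q (x + y)]. *)
Lemma minimal_sublinear_linear (R : realType) (V : lmodType R) (q : V -> R) :
  sublinear q ->
  (forall r, sublinear r -> (forall x, r x <= q x) -> r = q) ->
  linear (q : V -> R^o).
Proof.
move=> sq qmin; have [qD qZ] := sq.
have qDE x y : q (x + y) = q x + q y.
  apply/eqP; rewrite eq_le qD/= -lerBrDr.
  rewrite -{1}(qmin _ (lowering_sublinear y sq)); last first.
    by move=> z; exact: lowering_le_self.
  by have := lowering_le y x sq ler01; rewrite scale1r mul1r.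
have qN x : q (- x) = - q x.
  by apply/eqP; rewrite -addr_eq0 -qDE addNr (sublinear0 sq).
move=> a x y; rewrite qDE; congr (_ + _).
have [a0|a0] := leP 0 a; first by rewrite qZ.
by rewrite -[a]opprK scaleNr qN qZ ?oppr_ge0 ?ltW// scaleNr.
Qed.

Lemma Hahn_Banach (R : realType) (V : lmodType R) (p : V -> R) (x0 : V) :
  sublinear p ->
  exists f : {linear V -> R^o}, (forall x, f x <= p x) /\ f x0 = p x0.
Proof.
move=> sp; have [q [sq qle qmin]] :=
  exists_minimal_sublinear (lowering_sublinear x0 sp).
have lq := minimal_sublinear_linear sq qmin.
pose fL := GRing.isLinear.Build R V R^o *:%R q lq.
pose f : {linear V -> R^o} := HB.pack (q : V -> R^o) fL.
have fp x : f x <= p x by rewrite (le_trans (qle x))// lowering_le_self.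
exists f; split=> //; apply/eqP; rewrite eq_le fp/=.
(* [q] lies below [lowering p x0], whose value at [- x0] is at most [- p x0]. *)
have fN : f (- x0) = - f x0 :> R by exact: linearN.
rewrite -lerN2 -fN (le_trans (qle _))//.
have := lowering_le x0 (- x0) sp ler01.
by rewrite scale1r mul1r addNr (sublinear0 sp) sub0r.
Qed.

(** * Uniform boundedness *)

Lemma norming_functional (R : realType) (V : normedModType R) (x0 : V) :
  exists f : {linear V -> R^o}, (forall x, `|f x| <= `|x|) /\ f x0 = `|x0|.
Proof.
have sp : sublinear (fun x : V => `|x|).
  by split=> [x y|a x a0]; [exact: ler_normD|rewrite normrZ ger0_norm].
have [f [fle fx0]] := Hahn_Banach x0 sp.
exists f; split=> // x; rewrite ler_norml fle andbT.
have fN : f (- x) = - f x :> R by exact: linearN.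
by rewrite -lerN2 opprK -fN (le_trans (fle _))// normrN.
Qed.

(** The functional [\sum_j c j * f j] and its partial sums, for functionals of
    norm at most [1] and [`|c j| <= 3^-j]. *)
Lemma geometric_sum_functionals (R : realType) (V : normedModType R)
    (f : nat -> {linear V -> R^o}) (c : nat -> R) :
  (forall k x, `|f k x| <= `|x|) -> (forall k, `|c k| <= 3^-1 ^+ k) ->
  exists F : {linear V -> R^o}, bounded_op F /\ forall k x,
    `|F x - \sum_(j < k) c j * f j x| <= 3 / 2 * 3^-1 ^+ k * `|x|.
Proof.
move=> fle cle; pose g k x : R := \sum_(j < k) c j * f j x.
have gS k x : g k.+1 x = g k x + c k * f k x by rewrite /g big_ord_recr.
have gtail x k j :
    `|g (k + j)%N x - g k x| <= 3 / 2 * (3^-1 ^+ k - 3^-1 ^+ (k + j)) * `|x|.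
  elim: j => [|j IH]; first by rewrite addn0 !subrr normr0 mulr0 mul0r.
  rewrite addnS gS addrAC (le_trans (ler_normD _ _))//.
  (* [3 / 2 * (r ^+ n - r ^+ n.+1) = r ^+ n] for [r = 3^-1] *)
  have cf : `|c (k + j)%N * f (k + j)%N x| <= 3^-1 ^+ (k + j) * `|x|.
    by rewrite normrM ler_pM.
  rewrite (le_trans (lerD IH cf))// exprSr -mulrDl ler_wpM2r//.
  by rewrite le_eqVlt; apply/orP; left; apply/eqP; field.
have gcvg x : cvgn (g ^~ x).
  have -> : g ^~ x = series (fun j => c j * f j x).
    by apply/funext => k; rewrite seriesEord.
  apply: (@normed_cvg _ R^o); apply: (@series_le_cvg _ (fun j => `|c j * f j x| : R)
    (geometric `|x| 3^-1)).
  - by move=> n /=.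
  - by move=> n; apply: geometric_ge0; rewrite ?invr_ge0.
  - by move=> n; rewrite normrM mulrC ler_pM.
  - by apply: is_cvg_geometric_series; rewrite ger0_norm ?invr_ge0// invf_lt1 ?ltr1n.
pose F x : R := lim (g ^~ x @ \oo).
have FB x k : `|F x - g k x| <= 3 / 2 * 3^-1 ^+ k * `|x|.
  have : `|g n x - g k x| @[n --> \oo] --> `|F x - g k x|.
    by apply: cvg_norm; apply: cvgB; [exact: gcvg|exact: cvg_cst].
  move=> /cvgr_to_le; apply; near=> n.
  have kn : (k <= n)%N by near: n; exact: nbhs_infty_ge.
  rewrite -(subnKC kn) (le_trans (gtail _ _ _))// ler_wpM2r// ler_wpM2l//.
  by rewrite gerBl exprn_ge0// invr_ge0.
have Flin : linear (F : V -> R^o).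
  move=> a x y; apply: (@cvg_unique _ (@Rhausdorff R) (g^~ (a *: x + y) @ \oo)).
    exact: gcvg.
  rewrite (_ : g^~ _ = (fun k => a * g k x + g k y)).
    by apply: cvgD; [apply: cvgMl_tmp|]; exact: gcvg.
  apply/funext => k; rewrite /g mulr_sumr -big_split/=; apply: eq_bigr => j _.
  by rewrite linearP/= /GRing.scale/=; ring.
pose FL := GRing.isLinear.Build R V R^o *:%R F Flin.
pose Fl : {linear V -> R^o} := HB.pack (F : V -> R^o) FL.
exists Fl; split=> [|k x]; last exact: FB.
apply/linear_boundedP; near=> r => x /=.
have := FB x 0%N; rewrite /g big_ord0 subr0 expr0 mulr1 => /le_trans; apply.
by rewrite ler_wpM2r//; near: r; apply: nbhs_pinfty_ge; exact: num_real.
Unshelve. all: by end_near. Qed.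

(** Signs for the coefficients [+/- 3^-k], chosen one after the other so that
    the new term at [z k] has the sign of the sum of the previous ones. *)
Lemma exists_hump_signs (R : realType) (V : normedModType R)
    (f : nat -> {linear V -> R^o}) (z : nat -> V) :
  (forall k, f k (z k) = `|z k|) ->
  exists c : nat -> R, forall k, `|c k| = 3^-1 ^+ k /\
    3^-1 ^+ k * `|z k| <= `|\sum_(j < k.+1) c j * f j (z k)|.
Proof.
move=> fz; pose s (u : R) : R := if 0 <= u then 1 else -1.
pose g := fix g k x : R :=
  if k is j.+1 then g j x + s (g j (z j)) * 3^-1 ^+ j * f j x else 0.
pose c k := s (g k (z k)) * 3^-1 ^+ k.
have gE k x : g k x = \sum_(j < k) c j * f j x.
  by elim: k => [|k IH]; rewrite ?big_ord0// big_ord_recr/= -IH.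
exists c => k; have r0 : 0 <= 3^-1 ^+ k :> R by rewrite exprn_ge0// invr_ge0.
split; first by rewrite normrM (ger0_norm r0) /s; case: ifP; rewrite ?normrN normr1 mul1r.
have m0 : 0 <= 3^-1 ^+ k * `|z k| by rewrite mulr_ge0.
rewrite big_ord_recr/= -gE fz /c /s; case: ifPn => [g0|].
  by rewrite mul1r ger0_norm ?lerDr// addr_ge0.
by rewrite -ltNge => g0; rewrite mulN1r mulNr ler0_norm; lra.
Qed.

(** The uniform boundedness principle for a sequence of vectors tested against
    bounded functionals. *)
Lemma weakly_bounded_bounded (R : realType) (V : normedModType R) (x : nat -> V) :
  (forall f : {linear V -> R^o}, bounded_op f ->
     exists M : R, forall n, `|f (x n)| <= M) ->
  exists M : R, forall n, `|x n| <= M.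
Proof.
move=> xw; apply: contrapT => xunb.
have /choice[n nP] k : exists n, k%:R * 3 ^+ k < `|x n|.
  apply: contrapT => kn; apply: xunb; exists (k%:R * 3 ^+ k) => n.
  by rewrite leNgt; apply/negP => nk; apply: kn; exists n.
have /choice[f fP] k := norming_functional (x (n k)).
have [c cP] := exists_hump_signs (fun k => (fP k).2).
have cle k : `|c k| <= 3^-1 ^+ k by rewrite (cP k).1.
have [F [bF FP]] := geometric_sum_functionals (fun k => (fP k).1) cle.
have [M MP] := xw _ bF.
have [k Mk] : exists k : nat, M < 2^-1 * k%:R.
  exists (Num.bound `|2 * M|); rewrite ltr_pdivlMl//.
  by rewrite (le_lt_trans (ler_norm _))// archi_boundP.
pose S := \sum_(j < k.+1) c j * f j (x (n k)).
have Sge : 3^-1 ^+ k * `|x (n k)| <= `|S| by exact: (cP k).2.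
have FS : `|F (x (n k)) - S| <= 2^-1 * (3^-1 ^+ k * `|x (n k)|).
  rewrite (le_trans (FP k.+1 _))// le_eqVlt exprSr; apply/orP; left; apply/eqP.
  by field.
have zk : k%:R <= 3^-1 ^+ k * `|x (n k)|.
  by rewrite exprVn ler_pdivlMl ?exprn_gt0// mulrC ltW.
have tri : `|S| <= `|F (x (n k))| + `|F (x (n k)) - S|.
  by rewrite -lerBlDl -[`|F _ - S|]normrN opprB; exact: lerB_dist.
by have := MP (n k); lra.
Qed.

(** * Vector lattices *)

Section VectorLatticeTheory.
Context {R : realType} {E : vectorLatticeType R}.
Implicit Types (x y z : E) (a : R).

Lemma vl_leD x y z t : x <= y -> z <= t -> x + z <= y + t.
Proof.
move=> xy zt; apply: (@le_trans _ _ (y + z)); first exact: vle_add2r.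
by rewrite ![y + _]addrC; exact: vle_add2r.
Qed.

Lemma vl_leB0 x y : (0 <= y - x) = (x <= y).
Proof.
apply/idP/idP => h; first by have := vl_leD h (lexx x); rewrite add0r subrK.
by have := vl_leD h (lexx (- x)); rewrite subrr.
Qed.

Lemma vl_leN x y : (- x <= - y) = (y <= x).
Proof. by rewrite -[LHS]vl_leB0 opprK addrC vl_leB0. Qed.

Lemma vl_leZ a x y : 0 <= a -> x <= y -> a *: x <= a *: y.
Proof. exact: vle_scale2l. Qed.

Lemma vl_scale_ge0 a x : 0 <= a -> 0 <= x -> 0 <= a *: x.
Proof. by move=> a0 /(vl_leZ a0); rewrite scaler0. Qed.

Lemma vl_leZl a b x : 0 <= x -> a <= b -> a *: x <= b *: x.
Proof.
by move=> x0 ab; rewrite -vl_leB0 -scalerBl vl_scale_ge0// subr_ge0.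
Qed.

Lemma vl_leZ_inv a x y : 0 < a -> (a *: x <= y) = (x <= a^-1 *: y).
Proof.
move=> a0; apply/idP/idP => [/(vl_leZ (ltW _))|/(vl_leZ (ltW a0))].
  by move=> /(_ a^-1); rewrite scalerK ?gt_eqF// invr_gt0; apply.
by rewrite scalerA divff ?gt_eqF// scale1r.
Qed.

Lemma labs_leP x y : (labs x <= y) = (x <= y) && (- x <= y).
Proof. by rewrite /labs leUx. Qed.

Lemma le_labs x : x <= labs x.
Proof. exact: leUl. Qed.

Lemma leN_labs x : - x <= labs x.
Proof. exact: leUr. Qed.

Lemma labs_ge0 x : 0 <= labs x.
Proof.
have := vl_leD (le_labs x) (leN_labs x); rewrite subrr -mulr2n -scaler_nat.
move=> /(vl_leZ (_ : 0 <= 2^-1 :> R)); rewrite scaler0 scalerK ?pnatr_eq0//.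
by apply; rewrite invr_ge0.
Qed.

Lemma ge0_labs x : 0 <= x -> labs x = x.
Proof.
move=> x0; apply/le_anti; rewrite le_labs labs_leP lexx/= andbT.
by rewrite (le_trans _ x0)// -vl_leB0 sub0r opprK.
Qed.

Lemma labs_id x : labs (labs x) = labs x.
Proof. exact: ge0_labs (labs_ge0 x). Qed.

Lemma labsZ a x : 0 <= a -> labs (a *: x) = a *: labs x.
Proof.
have le_labsZ b z : 0 <= b -> labs (b *: z) <= b *: labs z.
  by move=> b0; rewrite labs_leP -scalerN !vl_leZ// ?le_labs ?leN_labs.
rewrite le_eqVlt => /predU1P[<-|a0]; first by rewrite !scale0r ge0_labs.
apply/le_anti; rewrite le_labsZ ?(ltW a0)//= vl_leZ_inv//.
by rewrite -{1}[x](scalerK (lt0r_neq0 a0)) le_labsZ// invr_ge0 (ltW a0).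
Qed.

Lemma labs_bounded_order_bounded (x : nat -> E) (u : E) :
  (forall n, labs (x n) <= u) -> order_bounded_seq x.
Proof.
move=> xu; exists (- u), u => n; have := xu n; rewrite labs_leP => /andP[-> xnu].
by rewrite -vl_leN opprK.
Qed.

Lemma sigma_laterally_complete_order_bounded (x : nat -> E) :
  sigma_laterally_complete E -> disjoint_seq x -> order_bounded_seq x.
Proof.
move=> sE xdisj; have [|n m /xdisj|u [ub _]] := sE (fun n => labs (x n)).
- by move=> n; exact: labs_ge0.
- by rewrite !labs_id.
- by apply: (@labs_bounded_order_bounded _ u) => n; apply: ub; exists n.
Qed.

End VectorLatticeTheory.

(** * Banach lattices *)

Section BanachLatticeTheory.
Context {R : realType} {E : banachLatticeType R}.
Implicit Types (x y : E).

Lemma norm_labs x : `|labs x| = `|x|.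
Proof. by apply/eqP; rewrite eq_le !norm_le_labs// labs_id. Qed.

(** The positive cone is closed: the negative part of the limit [l] is dominated
    by [labs (x n - l)] as soon as [0 <= x n], and [`|x n - l|] tends to [0]. *)
Lemma lattice_cvg_ge0 (x : nat -> E) (l : E) :
  x @ \oo --> l -> (\forall n \near \oo, 0 <= x n) -> 0 <= l.
Proof.
move=> xl x0; pose w : E := Order.join (- l) 0.
suff w0 : w = 0 by rewrite -vl_leN oppr0 -w0 leUl.
apply/eqP; rewrite -normr_eq0 eq_le normr_ge0 andbT.
have : `|x n - l| @[n --> \oo] --> (0 : R).
  by rewrite -(@normr0 _ E) -(subrr l); apply: cvg_norm; apply: cvgB => //; exact: cvg_cst.
move=> /cvgr_to_ge; apply; apply: filterS x0 => n x0.
apply: norm_le_labs; rewrite ge0_labs ?leUr// leUx labs_ge0 andbT.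
rewrite (le_trans _ (le_labs _))//.
by have := vl_leD x0 (lexx (- l)); rewrite add0r.
Qed.

(** The norm dominates, up to a constant, the gauge of an order unit. *)
Lemma order_unit_dominates (e : E) : order_unit e ->
  exists C : R, 0 <= C /\ forall y, labs y <= (C * `|y|) *: e.
Proof.
move=> [/ltW e0 eU]; apply: contrapT => noC.
have /choice[y yP] k : exists y : E, ~ labs y <= (4 ^+ k * `|y|) *: e.
  apply: contrapT => ky; apply: noC; exists (4 ^+ k); split=> [|y].
    by rewrite exprn_ge0.
  by apply: contrapT => yk; apply: ky; exists y.
have y_neq0 k : `|y k| != 0.
  apply/eqP => yk; apply: (yP k); rewrite yk mulr0 scale0r.
  by rewrite (normr0_eq0 yk) ge0_labs.
(* The factor [4 ^+ k] leaves [2 ^+ k] after the norms are scaled to [2^-1 ^+ k]. *)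
pose z k : E := (2^-1 ^+ k / `|y k|) *: labs (y k).
have c0 k : 0 < 2^-1 ^+ k / `|y k|.
  by rewrite divr_gt0 ?exprn_gt0 ?invr_gt0// lt_def y_neq0/=.
have z0 k : 0 <= z k by rewrite vl_scale_ge0 ?labs_ge0// (ltW (c0 k)).
have nz k : `|z k| = 2^-1 ^+ k by rewrite normrZ norm_labs (gtr0_norm (c0 k)) divfK.
have /cvg_ex[s zs] : cvgn (series z).
  apply: normed_cvg; rewrite /normed_series_of (_ : (fun k => `|z k|) = geometric 1 2^-1).
    by apply: is_cvg_geometric_series; rewrite ger0_norm ?invr_ge0// invf_lt1 ?ltr1n.
  by apply/funext => k; rewrite nz/= mul1r.
have zle k : z k <= s.
  rewrite -vl_leB0; apply: (@lattice_cvg_ge0 (fun n => series z n - z k)).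
    by apply: cvgB => //; exact: cvg_cst.
  near=> n; have kn : (k < n)%N by near: n; exact: nbhs_infty_gt.
  rewrite vl_leB0 seriesEord/= (bigD1 (Ordinal kn))//= -[leLHS]addr0.
  apply: vl_leD => //; elim/big_rec : _ => // i u _ u0.
  by have := vl_leD (z0 i) u0; rewrite addr0.
have [a a0 sa] := eU s.
have [k ak] : exists k : nat, a <= 2 ^+ k.
  exists (Num.bound a); rewrite -natrX (le_trans (ltW (archi_boundP (ltW a0))))//.
  by rewrite ler_nat ltnW// ltn_expl.
apply: (yP k); have := le_trans (zle k) (le_trans (le_labs s) sa).
rewrite /z (vl_leZ_inv _ _ (c0 k)).
move=> /le_trans; apply; rewrite scalerA vl_leZl//.
rewrite invfM invrK exprVn invrK mulrAC ler_wpM2r//.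
have -> : 4 ^+ k = 2 ^+ k * 2 ^+ k :> R by rewrite -exprMn; congr (_ ^+ _); ring.
by rewrite ler_wpM2l// exprn_ge0.
Unshelve. all: by end_near. Qed.

End BanachLatticeTheory.

(** * Order weakly compact operators *)

Lemma cvg_cesaro0 (R : realType) (V : normedModType R) (y : nat -> V) :
  (fun n => `|y n|) @ \oo --> (0 : R) -> Defs.cesaro y @ \oo --> (0 : V).
Proof.
move=> /sequences.cesaro y0; apply: norm_cvg0.
apply: (@squeeze_cvgr _ _ _ _ (cst 0) (arithmetic_mean (fun n => `|y n|))) => //;
  last exact: cvg_cst.
near=> m; rewrite normr_ge0/= /Defs.cesaro /arithmetic_mean normrZ/= seriesEord/=.
by rewrite ger0_norm ?invr_ge0// ler_wpM2l ?invr_ge0// ler_norm_sum.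
Unshelve. all: by end_near. Qed.

Unset Implicit Arguments.
Set Strict Implicit.

Theorem theorem3p25 (R : realType) (E : banachLatticeType R)
    (Y : completeNormedModType R)
    (hE : sigma_laterally_complete E \/ AM_space_with_unit E)
    (T : {linear E -> Y}) (hT : bounded_op T) :
  order_weakly_compact T -> disjoint_weak_Banach_Saks T.
Proof.
move=> Towc x xdisj xweak.
suff xbd : order_bounded_seq x.
  (* The sequence itself serves as the subsequence. *)
  by exists id; split=> //; exists 0; apply: cvg_cesaro0; exact: Towc.
case: hE => [sE|[_ [e eU]]].
  exact: sigma_laterally_complete_order_bounded.
have [M xM] : exists M : R, forall n, `|x n| <= M.
  apply: weakly_bounded_bounded => f /xweak/cvgP/cvg_seq_bounded.
  move=> [M [Mreal Mf]]; exists (M + 1) => n; apply: Mf => //.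
  by rewrite ltrDl.
have [C [C0 CP]] := order_unit_dominates eU.
apply: (@labs_bounded_order_bounded _ _ _ ((C * M) *: e)) => n.
rewrite (le_trans (CP _))// vl_leZl ?(ltW eU.1)//.
by rewrite ler_wpM2l.
Qed.
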